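(* Let $A \in \mathbb{R}^{M\times N}$ be a full-rank matrix with $m(A) > 0$, where $m(A) = \inf_{\|v\|=1,\, v\ge 0}\|Av\|$, and let $p, \Delta p \in \mathbb{R}^M$. Let $v_0 \ge 0$ be a minimizer of $\|Av-p\|$ over all $v\in\mathbb{R}^N$ with $v \ge 0$, and let $v_\Delta \ge 0$ be a minimizer of $\|Av-(p+\Delta p)\|$ over all $v\in\mathbb{R}^N$ with $v\ge 0$. Put $r_0 = Av_0 - p$, $r_\Delta = Av_\Delta - (p+\Delta p)$, $\Delta v = v_\Delta - v_0$ and $\Delta r = r_\Delta - r_0$. If $v_0 \neq 0$, then $$\frac{\|\Delta v\|}{\|v_0\|} \le \frac{\|A\|}{m(A)}\left(\frac{\|\Delta p+\Delta r\|}{\|p+r_0\|}+1\right)+1 .$$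
   Context: For a vector $v\in\mathbb{R}^N$, $v\ge 0$ means that every component of $v$ is non-negative. The vector norm $\|\cdot\|$ is the Euclidean norm and $\|A\|$ is the corresponding spectral (operator) norm of the matrix $A$. The quantity $m(A)$ can equivalently be written as $m(A)=\inf_{v\neq 0,\, v\ge 0}\|Av\|/\|v\|$. *)

(* Defs.v *)
From mathcomp Require Import all_boot all_order all_algebra.
From mathcomp Require Import classical_sets reals.

Set Implicit Arguments.
Unset Strict Implicit.
Unset Printing Implicit Defensive.

Import Order.TTheory GRing.Theory Num.Theory.

Local Open Scope classical_set_scope.
Local Open Scope ring_scope.

(* Euclidean norm. The norm `|v| that MathComp-Analysis puts on matrices is
   the sup norm, so it cannot be used here. *)
Definition norm2 (R : realType) (n : nat) (v : 'cV[R]_n) : R :=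
  Num.sqrt (\sum_(i < n) v i 0 ^+ 2).

Definition vec_ge0 (R : realType) (n : nat) (v : 'cV[R]_n) : Prop :=
  forall i : 'I_n, 0 <= v i 0.

(* Operator norm induced by norm2, i.e. the spectral norm. For n = 0 the set
   is empty and its [sup] is 0. *)
Definition opnorm2 (R : realType) (m n : nat) (A : 'M[R]_(m, n)) : R :=
  sup [set norm2 (A *m v) | v in [set v : 'cV[R]_n | norm2 v = 1]].

(* The constant m(A). For n = 0 the set is empty and its [inf] is 0. *)
Definition min_gain (R : realType) (m n : nat) (A : 'M[R]_(m, n)) : R :=
  inf [set norm2 (A *m v)
      | v in [set v : 'cV[R]_n | norm2 v = 1 /\ vec_ge0 v]].

Definition full_rank (R : realType) (m n : nat) (A : 'M[R]_(m, n)) : Prop :=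
  \rank A = minn m n.

Definition is_nnls_minimizer (R : realType) (m n : nat) (A : 'M[R]_(m, n))
    (p : 'cV[R]_m) (v : 'cV[R]_n) : Prop :=
  vec_ge0 v /\
  forall w : 'cV[R]_n, vec_ge0 w -> norm2 (A *m v - p) <= norm2 (A *m w - p).

(* Main.v *)
Require Import Defs.
From mathcomp Require Import all_boot all_order all_algebra.
From mathcomp Require Import classical_sets reals.
From mathcomp Require Import boolp ring.

Import Order.TTheory GRing.Theory Num.Theory.

Local Open Scope ring_scope.

(** Since [p + r0 = A v0] and [Dp + Dr = A Dv], the bound comes from
    [|Dv| <= |vD| + |v0|] and, as [vD >= 0],
    [m(A) |vD| <= |A vD| <= |A Dv| + |A v0|], after dividing by [|v0|] and
    using [1 / |v0| <= |A| / |A v0|]. *)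

Section Norm2.
Context {R : realType}.

Lemma norm2_ge0 (n : nat) (v : 'cV[R]_n) : 0 <= norm2 v.
Proof. exact: sqrtr_ge0. Qed.

Lemma sqr_norm2 (n : nat) (v : 'cV[R]_n) :
  norm2 v ^+ 2 = \sum_(i < n) v i 0 ^+ 2.
Proof. by rewrite sqr_sqrtr // sumr_ge0 // => i _; rewrite sqr_ge0. Qed.

Lemma norm2Z (n : nat) (c : R) (v : 'cV[R]_n) :
  norm2 (c *: v) = `|c| * norm2 v.
Proof.
rewrite /norm2 -sqrtr_sqr -sqrtrM ?sqr_ge0 // mulr_sumr.
by congr Num.sqrt; apply: eq_bigr => i _; rewrite mxE exprMn.
Qed.

Lemma norm2N (n : nat) (v : 'cV[R]_n) : norm2 (- v) = norm2 v.
Proof. by rewrite -scaleN1r norm2Z normrN1 mul1r. Qed.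

Lemma coord_le_norm2 (n : nat) (v : 'cV[R]_n) (i : 'I_n) :
  `|v i 0| <= norm2 v.
Proof.
rewrite -sqrtr_sqr ler_wsqrtr // (bigD1 i) //= lerDl sumr_ge0 // => j _.
exact: sqr_ge0.
Qed.

Lemma norm2_eq0 (n : nat) (v : 'cV[R]_n) : norm2 v = 0 -> v = 0.
Proof.
move=> v0; apply/colP => i; rewrite mxE; apply/normr0_eq0/le_anti.
by rewrite normr_ge0 andbT -v0 coord_le_norm2.
Qed.

Lemma norm2_gt0 (n : nat) (v : 'cV[R]_n) : v <> 0 -> 0 < norm2 v.
Proof.
by move=> nz; rewrite lt0r norm2_ge0 andbT; apply/eqP => /norm2_eq0.
Qed.

(** With [s] and [t] the norms of [u] and [v], the sum of squares of the entries of [t u - s v] is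
    nonnegative and expands to [2 s t (s t - <u, v>)]. Cancelling [2 s t] needs both norms positive,
    so zero vectors are treated first. *)
Lemma cauchy_schwarz_norm2 (n : nat) (u v : 'cV[R]_n) :
  \sum_(i < n) u i 0 * v i 0 <= norm2 u * norm2 v.
Proof.
set s := norm2 u; set t := norm2 v.
have [u0|/norm2_gt0 s_gt0] := pselect (u = 0).
  rewrite big1 ?mulr_ge0 ?norm2_ge0 // => i _.
  by rewrite u0 mxE mul0r.
have [v0|/norm2_gt0 t_gt0] := pselect (v = 0).
  rewrite big1 ?mulr_ge0 ?norm2_ge0 // => i _.
  by rewrite v0 mxE mulr0.
have : 0 <= \sum_(i < n) (t * u i 0 - s * v i 0) ^+ 2.
  by apply: sumr_ge0 => i _; apply: sqr_ge0.
have -> : \sum_(i < n) (t * u i 0 - s * v i 0) ^+ 2 =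
    2 * (s * t) * (s * t - \sum_(i < n) u i 0 * v i 0).
  transitivity (t ^+ 2 * (\sum_(i < n) u i 0 ^+ 2)
     - 2 * (s * t) * (\sum_(i < n) u i 0 * v i 0)
     + s ^+ 2 * (\sum_(i < n) v i 0 ^+ 2)).
    rewrite !mulr_sumr -sumrB -big_split /=.
    by apply: eq_bigr => i _; ring.
  by rewrite -!sqr_norm2 -/s -/t; ring.
by rewrite pmulr_rge0 ?mulr_gt0 // subr_ge0.
Qed.

(** After squaring both sides, only the cross terms differ, and Cauchy-Schwarz compares them. *)
Lemma norm2D (n : nat) (u v : 'cV[R]_n) : norm2 (u + v) <= norm2 u + norm2 v.
Proof.
rewrite -(@ler_pXn2r _ 2) // ?nnegrE ?addr_ge0 ?norm2_ge0 // sqrrD !sqr_norm2.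
have -> : \sum_(i < n) (u + v) i 0 ^+ 2 =
    \sum_(i < n) u i 0 ^+ 2 + (\sum_(i < n) u i 0 * v i 0) *+ 2
    + \sum_(i < n) v i 0 ^+ 2.
  rewrite -sumrMnl -!big_split /=; apply: eq_bigr => i _.
  by rewrite mxE sqrrD.
by rewrite lerD2r lerD2l lerMn2r cauchy_schwarz_norm2.
Qed.

Lemma norm2_normalize (n : nat) (v : 'cV[R]_n) :
  v <> 0 -> norm2 ((norm2 v)^-1 *: v) = 1.
Proof.
move=> /norm2_gt0 v_gt0.
by rewrite norm2Z gtr0_norm ?invr_gt0 // mulVf // gt_eqF.
Qed.

(** This makes the [sup] in [opnorm2] a true upper bound rather than a default value. *)
Lemma norm2_mulmx_bounded (m n : nat) (A : 'M[R]_(m, n)) :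
  exists C : R, forall v : 'cV[R]_n, norm2 v = 1 -> norm2 (A *m v) <= C.
Proof.
(* The witness is the Euclidean norm of the vector of absolute row sums: the entries of a unit
   vector are at most 1 in absolute value, so each entry of [A *m v] is bounded by its row sum. *)
exists (Num.sqrt (\sum_(i < m) (\sum_(j < n) `|A i j|) ^+ 2)) => v v1.
apply: ler_wsqrtr; apply: ler_sum => i _; rewrite mxE -real_normK ?num_real //.
rewrite ler_pXn2r // ?nnegrE // ?sumr_ge0 //.
apply: le_trans (ler_norm_sum _ _ _) _; apply: ler_sum => j _.
by rewrite normrM ler_piMr // -v1 coord_le_norm2.
Qed.

Lemma norm2_mulmx_le_opnorm2 (m n : nat) (A : 'M[R]_(m, n)) (v : 'cV[R]_n) :
  v <> 0 -> norm2 (A *m v) <= opnorm2 A * norm2 v.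
Proof.
move=> nz; have v_gt0 := norm2_gt0 _ _ nz.
rewrite -ler_pdivrMr // mulrC -[(norm2 v)^-1]gtr0_norm ?invr_gt0 //.
rewrite -norm2Z scalemxAr; apply: ub_le_sup.
  have [C hC] := norm2_mulmx_bounded _ _ A.
  by exists C => _ [w w1 <-]; apply: hC.
by exists ((norm2 v)^-1 *: v) => //=; apply: norm2_normalize.
Qed.

(** By homogeneity it suffices to treat the unit vector along [v], which stays nonnegative because
    the scaling factor is positive; the infimum is over a set bounded below by 0. *)
Lemma min_gain_le_norm2_mulmx (m n : nat) (A : 'M[R]_(m, n)) (v : 'cV[R]_n) :
  vec_ge0 v -> min_gain A * norm2 v <= norm2 (A *m v).
Proof.
move=> v_ge0; have [->|nz] := pselect (v = 0).
  (* Writing the zero vector as [0 *: 0] lets homogeneity give it norm 0. *)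
  by rewrite mulmx0 -(scale0r 0) norm2Z normr0 mul0r mulr0 norm2_ge0.
have v_gt0 := norm2_gt0 _ _ nz.
rewrite -ler_pdivlMr // mulrC -[(norm2 v)^-1]gtr0_norm ?invr_gt0 //.
rewrite -norm2Z scalemxAr; apply: ge_inf.
  by exists 0 => _ [w _ <-]; apply: norm2_ge0.
exists ((norm2 v)^-1 *: v) => //=; split; first exact: norm2_normalize.
by move=> i; rewrite mxE mulr_ge0 // invr_ge0 norm2_ge0.
Qed.

End Norm2.

Theorem mainTheorem1 (R : realType) (M N : nat) (A : 'M[R]_(M, N))
    (p Dp : 'cV[R]_M) (v0 vD : 'cV[R]_N)
    (A_full_rank : full_rank A)
    (mA_gt0 : 0 < min_gain A)
    (v0_min : is_nnls_minimizer A p v0)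
    (vD_min : is_nnls_minimizer A (p + Dp) vD)
    (v0_neq0 : v0 <> 0) :
  let r0 := A *m v0 - p in
  let rD := A *m vD - (p + Dp) in
  let Dv := vD - v0 in
  let Dr := rD - r0 in
  norm2 Dv / norm2 v0 <=
    opnorm2 A / min_gain A * (norm2 (Dp + Dr) / norm2 (p + r0) + 1) + 1.
Proof.
cbv zeta; set Dv := vD - v0.
have -> : p + (A *m v0 - p) = A *m v0 by rewrite addrC subrK.
have -> : Dp + (A *m vD - (p + Dp) - (A *m v0 - p)) = A *m Dv.
  by rewrite mulmxBr; apply/colP => i; rewrite !mxE; ring.
have v0_gt0 := norm2_gt0 _ _ v0_neq0.
have gain0 := min_gain_le_norm2_mulmx _ _ A _ v0_min.1.
have gainD := min_gain_le_norm2_mulmx _ _ A _ vD_min.1.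
have op0 := norm2_mulmx_le_opnorm2 _ _ A _ v0_neq0.
(* Positivity of [min_gain A] keeps [A *m v0] away from 0, so the quotient by its norm is
   genuine. *)
have Av0_gt0 : 0 < norm2 (A *m v0) by apply: lt_le_trans gain0; apply: mulr_gt0.
have tri_v : norm2 Dv <= norm2 vD + norm2 v0.
  by rewrite -(norm2N _ v0); apply: norm2D.
have tri_A : norm2 (A *m vD) <= norm2 (A *m Dv) + norm2 (A *m v0).
  by rewrite -[in X in X <= _](subrK v0 vD) mulmxDr; apply: norm2D.
(* The final [+ 1] of the bound absorbs the [norm2 v0] of [tri_v], leaving only [norm2 vD] to
   estimate. *)
rewrite ler_pdivrMr // mulrDl mul1r.
apply: le_trans tri_v _; rewrite lerD2r.
rewrite -(ler_pM2l mA_gt0); apply: le_trans gainD _; apply: le_trans tri_A _.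
have -> : min_gain A * (opnorm2 A / min_gain A *
    (norm2 (A *m Dv) / norm2 (A *m v0) + 1) * norm2 v0) =
    (norm2 (A *m Dv) / norm2 (A *m v0) + 1) * (opnorm2 A * norm2 v0).
  by field; rewrite !gt_eqF.
(* Factoring out [norm2 (A *m v0)] gives both sides the same nonnegative factor, so that [op0]
   concludes. *)
have -> : norm2 (A *m Dv) + norm2 (A *m v0) =
    (norm2 (A *m Dv) / norm2 (A *m v0) + 1) * norm2 (A *m v0).
  by field; rewrite gt_eqF.
by rewrite ler_wpM2l // addr_ge0 // divr_ge0 // norm2_ge0.
Qed.
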